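(* Let $\Gamma=\Lambda\times\Gamma_t$ be a finitely generated abelian group ($\Lambda$ free of rank $n$, $\Gamma_t$ finite), $T=\mathrm{Hom}(\Gamma,\mathbb{C}^* )$, and $X$ a finite list of nonzero elements of $\Lambda$ spanning a sublattice of finite index in $\Lambda$. Then $$(-1)^nM_X(1-q,0)=\chi(q),\qquad\text{where }\chi(q)=\sum_{C\in\mathcal{C}(X)}\mu(T_C,C)\,q^{\dim C}.$$
   Context: Each $\chi\in\Lambda$ gives a character $t\mapsto t(\chi)$ of $T$ with kernel $H_\chi=\{t:t(\chi)=1\}$; $H_A=\bigcap_{\chi\in A}H_\chi$ for $A\subseteq X$ ($H_\emptyset=T$). $\mathcal{C}(X)$ is the set of connected components of all $H_A$, ordered by reverse inclusion; $\mu$ is its Möbius function; $T_C$ is the connected component of $T$ containing $C$; $\dim C$ is the complex dimension. Let $\pi:\Gamma\to\Lambda$ be the projection. For a sublist $A$: $r(A)$ is the dimension of the real span of $\pi(A)$, $\langle A\rangle$ the subgroup generated by $A$, $\Gamma_A=\pi^{-1}(\Lambda\cap\langle\pi(A)\rangle_{\mathbb{R}})$, $m(A)=[\Gamma_A:\langle A\rangle]$, and $M_X(x,y)=\sum_{A\subseteq X}m(A)(x-1)^{r(X)-r(A)}(y-1)^{|A|-r(A)}$. *)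

(* Defs.v *)
From HB Require Import structures.
From mathcomp Require Import all_boot all_order all_algebra.
From mathcomp Require Import all_classical all_reals all_analysis.
Set Implicit Arguments. Unset Strict Implicit. Unset Printing Implicit Defensive.
Import Order.TTheory GRing.Theory Num.Theory.
Import numFieldNormedType.Exports.
Local Open Scope classical_set_scope.
Local Open Scope ring_scope.

Definition Lam (n : nat) := 'rV[int]_n.
Definition Gam (n : nat) (Gt : finZmodType) := (Lam n * Gt)%type.

(* complex numbers as pairs (re, im); pointwise topology on Gamma -> C *)
Definition cmul (R : realType) (z w : R * R) : R * R :=
  (z.1 * w.1 - z.2 * w.2, z.1 * w.2 + z.2 * w.1).

Definition TT (n : nat) (Gt : finZmodType) (R : realType) : topologicalType :=
  prod_topology (fun _ : Gam n Gt => ((R * R)%type : topologicalType)).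

Definition torus (n : nat) (Gt : finZmodType) (R : realType) : set (TT n Gt R) :=
  [set t | (forall g, t g <> (0, 0)) /\
           (forall g1 g2 : Gam n Gt, t (g1 + g2) = cmul (t g1) (t g2))].

Import numFieldNormedType.Exports.

Section Defs.
Variables (n : nat) (Gt : finZmodType) (R : realType) (X : seq (Lam n)).
Let Ga := Gam n Gt.
Let T := TT n Gt R.
Let I := 'I_(size X).

Definition HA (S : {set I}) : set T :=
  [set t | @torus n Gt R t /\ forall i : I, i \in S -> t (X`_i, 0) = (1, 0)].

Definition comps (S : {set I}) : set (set T) :=
  [set connected_component (HA S) t | t in HA S].

Definition layers : set (set T) := [set C | exists S : {set I}, comps S C].

(* T_C, the connected component of T containing C *)
Definition TC (C : set T) : set T :=
  \bigcup_(c in C) connected_component (@torus n Gt R) c.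

(* one-parameter subgroup s |-> exp(s V), V = a + i b in Lie(T) = C^n *)
Definition expdir (V : 'rV[R]_(n + n)) (s : R) : Ga -> R * R :=
  fun g => let u := s * \sum_(j < n) (g.1 0 j)%:~R * lsubmx V 0 j in
           let v := s * \sum_(j < n) (g.1 0 j)%:~R * rsubmx V 0 j in
           (expR u * cos v, expR u * sin v).

(* real Lie algebra of (the stabiliser of) C *)
Definition lie (C : set T) : set 'rV[R]_(n + n) :=
  [set V | forall (s : R) (t : T), C t ->
             C (fun g : Ga => cmul (t g) (expdir V s g) : R * R)].

Definition realdim (C : set T) : nat :=
  \max_(k < (n + n).+1 |
     `[< exists M : 'M[R]_(k, n + n), row_free M /\ forall i, lie C (row i M) >]) k.

Definition cdim (C : set T) : nat := (realdim C)./2.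

Definition rk (S : {set I}) : nat :=
  \rank (\matrix_(i < size X, j < n) (if i \in S then (X`_i 0 j)%:~R else 0 : R)).

Definition GammaA (S : {set I}) : set Ga :=
  [set g : Ga | exists c : I -> R, map_mx intr g.1 = \sum_(i in S) c i *: map_mx intr X`_i].

Definition genA (S : {set I}) : set Ga :=
  [set g : Ga | g.2 = 0 /\ exists c : I -> int, g.1 = \sum_(i in S) X`_i *~ c i].

Definition is_index (Hs Ks : set Ga) (k : nat) : Prop :=
  exists s : seq Ga,
    [/\ size s = k, (forall g, g \in s -> Hs g),
        (forall i j : nat, (i < k)%N -> (j < k)%N -> i <> j ->
            ~ Ks (nth 0 s i - nth 0 s j)) &
        (forall h, Hs h -> exists2 g, g \in s & Ks (h - g))].

Definition mult (S : {set I}) : nat := xget 0%N (is_index (GammaA S) (genA S)).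

Definition tutteM (Rg : comNzRingType) (x y : Rg) : Rg :=
  \sum_(S : {set I}) (mult S)%:R * (x - 1) ^+ (rk [set: I]%SET - rk S)
                                  * (y - 1) ^+ (#|S| - rk S).

End Defs.

Definition is_mobius (T : Type) (P : set (set T)) (mu : set T -> set T -> int) : Prop :=
  forall x y, P x -> P y ->
    mu x y = if `[< x = y >] then 1
             else if `[< y `<=` x >] then
               - (\sum_(z \in [set z | [/\ P z, z `<=` x, y `<=` z & z <> y]]) mu x z)
             else 0.

(* Main.v *)
(* Let [f C] be the sum of [(-1)^|A|] over the [A] having [C] among the
   components of [H_A].  A connected [C] lies in at most one component
   of a given [H_A], so summing [f] over the layers containing [C] leaves the
   alternating sum over the subsets of [{i | chi_i = 1 on C}]; this set is empty
   exactly when [C] is a component of [T], because a nonzero element of [Lambda]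
   is nonconstant on every component of [T].  Hence [f C = mu(T_C, C)].  On the
   other side [M_X(1 - q, 0)] is, up to sign, the sum over [A] of
   [(-1)^|A| m(A) q^(n - r(A))], and [H_A] has exactly [m(A)] components, all of
   dimension [n - r(A)].  The component count comes from the Smith normal form,
   which gives generators [u_j] of [Gamma] and integers [d_j] such that a
   combination of the [u_j] is in [<A>] iff each [d_j] divides its [j]-th
   coefficient: both the cosets of [<A>] in [Gamma_A] and the components of [H_A]
   are then indexed by the residues modulo the nonzero [d_j]. *)
Require Import Defs.
From HB Require Import structures.
From mathcomp Require Import all_boot all_order all_algebra.
From mathcomp Require Import all_classical all_reals all_analysis.
From mathcomp Require Import finmap zify ring lra.
Set Implicit Arguments. Unset Strict Implicit. Unset Printing Implicit Defensive.
Import Order.TTheory GRing.Theory Num.Theory.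
Import numFieldNormedType.Exports.
Local Open Scope classical_set_scope.
Local Open Scope ring_scope.

(** * The complex exponential *)

Section ComplexExponential.
Variable R : realType.
Implicit Types z w : R * R.

Definition cexp w : R * R := (expR w.1 * cos w.2, expR w.1 * sin w.2).

Lemma cmulC z w : cmul z w = cmul w z.
Proof. by rewrite /cmul; congr pair; ring. Qed.

Lemma cmulA z w u : cmul z (cmul w u) = cmul (cmul z w) u.
Proof. by rewrite /cmul /=; congr pair; ring. Qed.

Lemma cmul1 z : cmul z (1, 0) = z.
Proof. by case: z => a b; rewrite /cmul /=; congr pair; ring. Qed.

Lemma cexpD w w' : cexp (w + w') = cmul (cexp w) (cexp w').
Proof. by rewrite /cexp /cmul /= expRD cosD sinD; congr pair; ring. Qed.

Lemma cexp0 : cexp 0 = (1, 0).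
Proof. by rewrite /cexp /= expR0 cos0 sin0 mulr1 mulr0. Qed.

Lemma cmul_cexpI w : injective (cmul (cexp w)).
Proof.
move=> z z' /(congr1 (cmul (cexp (- w)))).
by rewrite !cmulA -cexpD addNr cexp0 ![cmul (1, 0) _]cmulC !cmul1.
Qed.

Lemma cexp_neq0 w : cexp w <> (0, 0).
Proof.
move=> [] /eqP + /eqP; rewrite !mulf_eq0 !expR_eq0 /= => /eqP c0 /eqP s0.
by have := cos2Dsin2 w.2; rewrite c0 s0 expr0n addr0 => /eqP; rewrite eq_sym oner_eq0.
Qed.

Lemma cos_sin_period (x : R) (k : int) :
  cos (x + (pi *+ 2) *~ k) = cos x /\ sin (x + (pi *+ 2) *~ k) = sin x.
Proof.
have N m y : cos (y + (pi *+ 2) *+ m) = cos y :> R /\ sin (y + (pi *+ 2) *+ m) = sin y :> R.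
  by rewrite !periodicn //; [exact: sinD2pi|exact: cosD2pi].
case: k => m; first exact: N.
rewrite NegzE mulrNz.
by have [<- <-] := N m.+1 (x - (pi *+ 2) *~ m.+1); rewrite subrK.
Qed.

(** Subtracting a multiple of $2\pi$ leaves $0\le y<2\pi$. There $\cos y=1-2\sin^2(y/2)$, and
    $\sin(y/2)>0$ unless $y=0$. *)
Lemma cos_eq1 (x : R) : cos x = 1 -> exists k : int, x = (pi *+ 2) *~ k.
Proof.
move=> cx; have p0 : 0 < (pi *+ 2 : R) by rewrite pmulrn_lgt0 // pi_gt0.
pose k := Num.floor (x / (pi *+ 2)); exists k.
pose y := x - (pi *+ 2) *~ k.
have xy : x = y + (pi *+ 2) *~ k by rewrite subrK.
have y0 : 0 <= y.
  rewrite subr_ge0 -mulrzr mulrC -ler_pdivlMr //.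
  exact: floor_le.
have y1 : y < pi *+ 2.
  have := floorD1_gt (x / (pi *+ 2)).
  by rewrite ltr_pdivrMr // intrD mulrDl mul1r mulrzl ltrBlDl.
have cy : cos y = 1 by have [<- _] := cos_sin_period y k; rewrite -xy.
have [y_eq0|ynz] := eqVneq y 0; first by rewrite xy y_eq0 add0r.
have y2 : (y / 2) *+ 2 = y by rewrite -mulr_natr divfK ?pnatr_eq0.
have yh : cos ((y / 2) *+ 2) = 1 by rewrite y2.
have : 0 < sin (y / 2).
  have yp : 0 < y by rewrite lt_def ynz.
  by apply: sin_gt0_pi; lra.
rewrite cos_mulr2n cos2sin2 in yh.
have s0 : sin (y / 2) ^+ 2 = 0 by lra.
by move: s0 => /eqP; rewrite sqrf_eq0 => /eqP ->; rewrite ltxx.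
Qed.

Lemma cexp_eq1 w : cexp w = (1, 0) <-> exists k : int, w = (0, (pi *+ 2) *~ k).
Proof.
split=> [|[k ->]]; last first.
  rewrite /cexp /= expR0 !mul1r; congr pair.
    by have [+ _] := cos_sin_period 0 k; rewrite add0r cos0.
  by have [_] := cos_sin_period 0 k; rewrite add0r sin0.
case: w => a b [] ec es.
have sb : sin b = 0.
  by move/eqP: es; rewrite mulf_eq0 expR_eq0 /= => /eqP.
have cb : `|cos b| = 1 by apply: sin0cos1.
have ea : expR a = 1.
  have := congr1 Num.norm ec; rewrite /= normrM cb mulr1 normr1.
  by rewrite ger0_norm // expR_ge0.
move: ec; rewrite /= ea mul1r => /cos_eq1[k ->]; exists k; congr pair.
by apply: expR_inj; rewrite ea expR0.
Qed.

Lemma cexp_eq w w' : cexp w = cexp w' <-> cexp (w - w') = (1, 0).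
Proof.
split=> [e|e].
  apply: (@cmul_cexpI w'); rewrite -cexpD addrC subrK cmul1 //.
by rewrite -[w](subrK w') addrC cexpD e cmul1.
Qed.

(** Polar form: the logarithm of the modulus [r], and an argument obtained from [acos]. *)
Lemma cexp_surj z : z <> (0, 0) -> exists w, z = cexp w.
Proof.
case: z => x y nz.
have sq : 0 < x ^+ 2 + y ^+ 2.
  rewrite lt_def addr_ge0 ?sqr_ge0 // andbT.
  apply/negP; rewrite paddr_eq0 ?sqr_ge0 // !sqrf_eq0 => /andP[/eqP x0 /eqP y0].
  by apply: nz; rewrite x0 y0.
pose r := Num.sqrt (x ^+ 2 + y ^+ 2).
have r0 : 0 < r by rewrite sqrtr_gt0.
have r2 : r ^+ 2 = x ^+ 2 + y ^+ 2 by rewrite sqr_sqrtr // ltW.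
have rN : r != 0 by rewrite gt_eqF.
have e1 : (x / r) ^+ 2 + (y / r) ^+ 2 = 1.
  by rewrite !expr_div_n -mulrDl -r2 divff // sqrf_eq0.
have c1 : -1 <= x / r <= 1.
  by rewrite -ler_norml -(@ler_pXn2r _ 2) ?nnegrE // expr1n real_normK ?num_real //
    -e1 lerDl sqr_ge0.
have ca : cos (acos (x / r)) = x / r by apply: acosK; rewrite in_itv.
have sa : sin (acos (x / r)) = `|y / r|.
  rewrite sin_acos //; have -> : 1 - (x / r) ^+ 2 = (y / r) ^+ 2 by rewrite -e1; ring.
  by rewrite sqrtr_sqr.
have er : expR (ln r) = r by rewrite lnK.
(* [acos] only yields arguments with nonnegative sine, so the argument changes sign in the lower
   half plane. *)
have [yp|yn] := leP 0 (y / r).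
  exists (ln r, acos (x / r)); rewrite /cexp /= er ca sa ger0_norm //.
  by congr pair; field.
exists (ln r, - acos (x / r)); rewrite /cexp /= er cosN sinN ca sa ltr0_norm //.
by congr pair; field.
Qed.

End ComplexExponential.

(** * Presentations of finitely generated abelian groups *)

(** Writing $A=LDU$ in Smith form, [U] changes the generators [e] into [u], [L] only changes the
    basis of relations, and the diagonal of [D] gives the divisors. The generators may satisfy
    relations in [G]: only the preimage of [K] in $\mathbb{Z}^N$ matters. *)
Lemma elementary_divisors (G : zmodType) (N m : nat) (e : 'I_N -> G)
    (K : set G) (A : 'M[int]_(m, N)) :
  (forall g, exists v : 'rV[int]_N, g = \sum_k e k *~ v 0 k) ->
  (forall v : 'rV[int]_N, K (\sum_k e k *~ v 0 k) <-> exists c, v = c *m A) ->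
  exists (u : 'I_N -> G) (d : 'I_N -> nat),
    (forall g, exists a : 'I_N -> int, g = \sum_j u j *~ a j) /\
    (forall a : 'I_N -> int, K (\sum_j u j *~ a j) <-> forall j, (d j %| a j)%Z).
Proof.
move=> gen KA.
have [L uL [U uU [D _ AE]]] := int_Smith_normal_form A.
pose u j := \sum_k e k *~ U j k.
have uE (a : 'rV[int]_N) : \sum_j u j *~ a 0 j = \sum_k e k *~ (a *m U) 0 k.
  under eq_bigr do rewrite mulrz_suml.
  rewrite exchange_big; apply: eq_bigr => k _.
  rewrite mxE mulrz_sumr; apply: eq_bigr => j _.
  by rewrite -mulrzA mulrC.
(* A column beyond the [m] rows of [D] is zero, so its divisor is 0; the default of [nth] gives 0
   likewise when [D] is a short list. *)
exists u, (fun j => if (j < m)%N then `|(D`_j)%R|%N else 0%N); split.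
  move=> g; have [v ->] := gen g.
  exists (fun j => (v *m invmx U) 0 j).
  by rewrite (uE (v *m invmx U)) mulmxKV.
move=> a.
have -> : \sum_j u j *~ a j = \sum_k e k *~ ((\row_j a j) *m U) 0 k.
  by rewrite -uE; apply: eq_bigr => j _; rewrite mxE.
have DE (c : 'rV[int]_m) j :
    (c *m (\matrix_(i, j) (D`_i *+ (i == j :> nat)))) 0 j =
    \sum_(i < m | i == j :> nat) c 0 i * D`_j.
  rewrite mxE [RHS]big_mkcond /=; apply: eq_bigr => i _.
  by rewrite mxE; case: eqP => [->|_]; rewrite ?mulr1n // mulr0n mulr0.
rewrite KA; split=> [[c aE] j|dv].
  have {}aE : \row_j a j = c *m L *m (\matrix_(i, j) (D`_i *+ (i == j :> nat))).
    by apply: (can_inj (mulmxK uU)); rewrite aE AE !mulmxA.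
  have -> : a j = (\row_j a j) 0 j by rewrite mxE.
  rewrite aE DE; case: ifPn => jm.
    rewrite (big_pred1 (Ordinal jm)) //= dvdz_mull //.
    by rewrite dvdzE.
  rewrite big1 // => i /eqP ij.
  by rewrite -ij ltn_ord in jm.
(* Solves $a=cD$ entry by entry; rows with index at least [N] are zero in [D], so their coefficient
   is arbitrary and set to 0. *)
pose c := \row_(i < m) (if (insub (val i) : option 'I_N) is Some j then (a j %/ D`_j)%Z else 0).
exists (c *m invmx L); rewrite AE !mulmxA mulmxKV //; congr (_ *m _).
apply/rowP => j; rewrite DE mxE; move: (dv j); case: ifPn => jm dj.
  rewrite (big_pred1 (Ordinal jm)) //= mxE insubT //= => jN.
  have -> : Sub (val j) jN = j by apply: val_inj.
  by rewrite divzK // dvdzE; rewrite dvdzE in dj.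
rewrite big1; first by move: dj; rewrite dvd0z => /eqP.
by move=> i /eqP ij; rewrite -ij ltn_ord in jm.
Qed.

Section FiniteGroupPresentation.
Variable G : finZmodType.
Let e (g : G) : 'rV[int]_#|G| := delta_mx 0 (enum_rank g).

(** Presents [G] by all its elements subject to its addition table, so that no decomposition into
    cyclic groups is called for. *)
Definition cayley_relations : 'M[int]_(#|{: G * G}|, #|G|) :=
  \matrix_(k < #|{: G * G}|) (let gh := enum_val k in e gh.1 + e gh.2 - e (gh.1 + gh.2)).

Lemma sum_delta (g : G) : \sum_k enum_val k *~ e g 0 k = g.
Proof.
rewrite (bigD1 (enum_rank g)) //= big1 => [|k kg].
  by rewrite mxE !eqxx enum_rankK addr0.
by rewrite mxE (negbTE kg) andbF.
Qed.

(** Modulo the relations every [w] is congruent to the single generator [e (s w)]. If [s w = 0] this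
    is [e 0], which is itself a relation. *)
Lemma cayley_relationsP (v : 'rV[int]_#|G|) :
  \sum_k (enum_val k : G) *~ v 0 k = 0 <-> exists c, v = c *m cayley_relations.
Proof.
pose s (w : 'rV[int]_#|G|) : G := \sum_k enum_val k *~ w 0 k.
have sD u w : s (u + w) = s u + s w.
  by rewrite /s -big_split /=; apply: eq_bigr => k _; rewrite mxE mulrzDr.
have sZ (a : int) w : s (a *: w) = s w *~ a.
  by rewrite /s mulrz_suml; apply: eq_bigr => k _; rewrite mxE mulrC mulrzA.
have s_e g : s (e g) = g := sum_delta g.
have rowR k : row k cayley_relations =
  let gh := enum_val k in e gh.1 + e gh.2 - e (gh.1 + gh.2) by rewrite rowK.
have s0 : s 0 = 0 by rewrite /s big1 // => k _; rewrite mxE.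
split=> [sv0|[c ->]]; last first.
  rewrite -/(s _) mulmx_sum_row.
  have ssum (F : 'I_#|{: G * G}| -> 'rV_#|G|) : s (\sum_k F k) = \sum_k s (F k).
    by apply: (big_morph s sD s0).
  rewrite ssum big1 // => k _; rewrite sZ rowR /= -scaleN1r !sD sZ !s_e.
  by rewrite mulrN1z subrr mul0rz.
pose P (w : 'rV[int]_#|G|) := exists c, w = c *m cayley_relations.
have PD v1 v2 : P v1 -> P v2 -> P (v1 + v2).
  by move=> [c1 ->] [c2 ->]; exists (c1 + c2); rewrite mulmxDl.
have PN v1 : P v1 -> P (- v1) by move=> [c ->]; exists (- c); rewrite mulNmx.
have PR g h : P (e g + e h - e (g + h)).
  exists (delta_mx 0 (enum_rank (g, h))).
  by rewrite -rowE rowK enum_rankK.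
(* The relation of the pair $(0,0)$ is $e_0+e_0-e_0$. *)
have P0 : P (e 0) by have := PR 0 0; rewrite addr0 addrK.
pose Q w := P (w - e (s w)).
have QD v1 v2 : Q v1 -> Q v2 -> Q (v1 + v2).
  move=> q1 q2; rewrite /Q sD.
  have := PD _ _ (PD _ _ q1 q2) (PR (s v1) (s v2)); congr P; apply/rowP => k; rewrite !mxE; ring.
have QN v1 : Q v1 -> Q (- v1).
  move=> q1; rewrite /Q -scaleN1r sZ mulrN1z scaleN1r.
  (* The relation of the pair [(s v1, - s v1)] ends in [e 0], which [P0] then removes. *)
  have := PD _ _ (PN _ (PD _ _ q1 (PR (s v1) (- s v1)))) (PN _ P0).
  rewrite subrr; congr P; apply/rowP => k; rewrite !mxE; ring.
have Q0 : Q 0 by rewrite /Q s0 sub0r; apply: PN.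
have Qe g : Q (e g).
  by rewrite /Q s_e subrr; exists 0; rewrite mul0mx.
have QM (a : nat) v1 : Q v1 -> Q (v1 *+ a).
  by move=> q; elim: a => [|a IH]; rewrite ?mulr0n // mulrS; apply: QD.
have : Q v.
  have -> : v = \sum_k v 0 k *: e (enum_val k).
    rewrite [LHS]row_sum_delta; apply: eq_bigr => k _.
    by rewrite /e enum_valK.
  elim/big_ind: _ => // k _; rewrite -[v 0 k]intz scaler_int.
  case: (v 0 k) => a; first by apply: QM.
  by rewrite NegzE mulrNz; apply: QN; apply: QM.
rewrite /Q [s v]sv0 => q.
by have := PD _ _ q P0; rewrite subrK.
Qed.

End FiniteGroupPresentation.

Lemma ratr_common_denominator (I : finType) (c : I -> rat) :
  exists2 m : nat, (0 < m)%N & exists z : I -> int, forall i, c i *+ m = (z i)%:~R.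
Proof.
exists (\prod_i `|denq (c i)|)%N.
  by apply: prodn_gt0 => i; rewrite absz_gt0 denq_neq0.
exists (fun i => numq (c i) * (\prod_(j | j != i) `|denq (c j)|)%N%:Z) => i.
rewrite (bigD1 i) //= mulrnA intrM numqE -[LHS]mulr_natr -[c i *+ _]mulr_natr.
by rewrite -[in RHS]absz_denq.

Qed.

(** Translation by [g] permutes [G], so adding [g] to each summand leaves the sum of all elements
    unchanged. *)
Lemma mulrn_card_finZmod (G : finZmodType) (g : G) : g *+ #|G| = 0.
Proof.
apply: (addrI (\sum_(h : G) h)); rewrite addr0 -sumr_const -big_split /=.
by rewrite [RHS](reindex_inj (addIr g)).
Qed.

(** * The subgroup generated by a sublist, and its saturation *)

Section SublistSubgroup.
Variables (n : nat) (Gt : finZmodType) (X : seq (Lam n)) (S : {set 'I_(size X)}).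

(** [Gam n Gt] is generated by the basis of [Lam n] and all elements of [Gt]; in these generators
    [genA S] is the row space of a block matrix made of the sublist and the addition table of
    [Gt]. *)
Lemma genA_elementary_divisors :
  exists (N : nat) (u : 'I_N -> Gam n Gt) (d : 'I_N -> nat),
    (forall g, exists a : 'I_N -> int, g = \sum_j u j *~ a j) /\
    (forall a : 'I_N -> int,
       genA S (\sum_j u j *~ a j) <-> forall j, (d j %| a j)%Z).
Proof.
pose e (k : 'I_(n + #|Gt|)) : Gam n Gt :=
  match fintype.split k with inl j => (delta_mx 0 j, 0) | inr h => (0, enum_val h) end.
have eE (v : 'rV[int]_(n + #|Gt|)) :
    \sum_k e k *~ v 0 k = (lsubmx v, \sum_k enum_val k *~ rsubmx v 0 k).
  have lE j : e (lshift _ j) = (delta_mx 0 j, 0).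
    by rewrite /e -[lshift _ j]/(unsplit (inl j)) unsplitK.
  have rE j : e (rshift _ j) = (0, enum_val j).
    by rewrite /e -[rshift _ j]/(unsplit (inr j)) unsplitK.
  rewrite big_split_ord /=.
  have fstM : {morph (fst : Gam n Gt -> _) : x y / x + y} by [].
  have sndM : {morph (snd : Gam n Gt -> _) : x y / x + y} by [].
  have fstZ x (a : int) : (x *~ a : Gam n Gt).1 = x.1 *~ a.
    by exact: (raddfMz (fst : {additive Gam n Gt -> Lam n})).
  have sndZ x (a : int) : (x *~ a : Gam n Gt).2 = x.2 *~ a.
    by exact: (raddfMz (snd : {additive Gam n Gt -> Gt})).
  rewrite [LHS]surjective_pairing; congr pair.
    rewrite fstM !(big_morph _ fstM (erefl _)) [X in _ + X]big1 => [|k _]; last first.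
      by rewrite fstZ rE mul0rz.
    rewrite addr0 [RHS]row_sum_delta; apply: eq_bigr => j _.
    by rewrite fstZ lE mxE -[in RHS](intz (v _ _)) scaler_int.
  rewrite sndM !(big_morph _ sndM (erefl _)) [X in X + _]big1 => [|k _]; last first.
    by rewrite sndZ lE mul0rz.
  by rewrite add0r; apply: eq_bigr => j _; rewrite sndZ rE mxE.
pose M : 'M[int]_(size X, n) := \matrix_i (if i \in S then X`_i else 0).
have ME (c : 'rV_(size X)) : c *m M = \sum_(i in S) X`_i *~ c 0 i.
  rewrite mulmx_sum_row [RHS]big_mkcond /=; apply: eq_bigr => i _.
  by rewrite rowK -[c 0 i in LHS]intz scaler_int; case: ifP; rewrite ?mul0rz.
exists (n + #|Gt|)%N.
apply: (@elementary_divisors _ _ _ e _ (block_mx M 0 0 (cayley_relations Gt))).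
  move=> [l h]; exists (row_mx l (delta_mx 0 (enum_rank h))).
  by rewrite eE row_mxKl row_mxKr sum_delta.
move=> v; rewrite eE; split.
  move=> [/= /cayley_relationsP[c2 c2E] [c cE]].
  exists (row_mx (\row_i c i) c2).
  rewrite mul_row_block !mulmx0 addr0 add0r -c2E ME -[LHS]hsubmxK; congr row_mx.
  by rewrite cE; apply: eq_bigr => i _; rewrite mxE.
move=> [c ->]; rewrite -[c]hsubmxK mul_row_block !mulmx0 addr0 add0r.
rewrite row_mxKl row_mxKr; split => /=.
  by apply/cayley_relationsP; exists (rsubmx c).
by rewrite ME; exists (fun i => lsubmx c 0 i).
Qed.

Lemma genA_sub g h : genA S g -> genA S h -> genA S (g - h : Gam n Gt).
Proof.
move=> [g2 [c cE]] [h2 [c' c'E]]; split; first by rewrite /= g2 h2 subr0.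
exists (fun i => c i - c' i); rewrite /= cE c'E -sumrB.
by apply: eq_bigr => i _; rewrite mulrzBr.
Qed.

(** Replaces the real span by a purely arithmetic condition. A linear system with rational data
    solvable over [R] is solvable over the rationals, and denominators can be cleared. *)
Lemma GammaA_torsion (R : realType) (g : Gam n Gt) :
  GammaA R S g <-> exists2 m : nat, (0 < m)%N & genA S (g *+ m).
Proof.
have fstM (m : nat) : (g *+ m).1 = g.1 *+ m.
  exact: (raddfMn (fst : {additive Gam n Gt -> Lam n})).
have sndM (m : nat) : (g *+ m).2 = g.2 *+ m.
  exact: (raddfMn (snd : {additive Gam n Gt -> Gt})).
split=> [[c cE]|[m m0 [_ [c cE]]]]; last first.
  exists (fun i => (c i)%:~R / m%:R).
  have mN : m%:R != 0 :> R by rewrite pnatr_eq0 -lt0n.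
  apply: (can_inj (scalerK mN)); rewrite scaler_sumr.
  transitivity (map_mx intr (g.1 *+ m) : 'rV[R]_n).
    by apply/rowP => j; rewrite !mxE mulmxnE rmorphMn mulr_natl.
  rewrite -fstM cE.
  rewrite (raddf_sum (map_mx intr : {additive 'rV[int]_n -> 'rV[R]_n})).
  apply: eq_bigr => i _; rewrite scalerA mulrC divfK // scaler_int.
  exact: (raddfMz (map_mx intr : {additive 'rV[int]_n -> 'rV[R]_n})).
pose Q (F : fieldType) : 'M[F]_(size X, n) :=
  \matrix_i (if i \in S then map_mx intr X`_i else 0).
have QE (F : fieldType) (b : 'rV[F]_(size X)) :
    b *m Q F = \sum_(i in S) b 0 i *: map_mx intr X`_i.
  rewrite mulmx_sum_row [RHS]big_mkcond /=; apply: eq_bigr => i _.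
  by rewrite rowK; case: ifP; rewrite ?scaler0.
have rI k : map_mx ratr (map_mx intr k : 'rV[rat]_n) = map_mx intr k :> 'rV[R]_n.
  by apply/rowP => j; rewrite !mxE ratr_int.
(* Membership in a row space is insensitive to field extension. *)
have : (map_mx intr g.1 <= Q rat)%MS.
  rewrite -(map_submx (ratr : {rmorphism rat -> R})) rI.
  have -> : map_mx ratr (Q rat) = Q R.
    apply/row_matrixP => i; rewrite -map_row !rowK.
    by case: ifP => _; rewrite ?rI // map_mx0.
  by apply/submxP; exists (\row_i c i); rewrite QE cE; apply: eq_bigr => i _; rewrite mxE.
move=> /submxP[b bE].
have [m m0 [z zE]] := ratr_common_denominator (fun i => b 0 i).
(* [m] clears the denominators, and [#|Gt|] kills the torsion component of [g]. *)
exists (m * #|Gt|)%N.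
  by rewrite muln_gt0 m0; apply/card_gt0P; exists 0.
split; first by rewrite sndM mulnC mulrnA mulrn_card_finZmod mul0rn.
exists (fun i => z i * #|Gt|%:Z).
rewrite fstM mulrnA; under eq_bigr do rewrite mulrzA.
rewrite -mulrz_suml -pmulrn; congr (_ *+ _).
have inj : injective (map_mx intr : 'rV[int]_n -> 'rV[rat]_n).
  by move=> a a' /rowP e; apply/rowP => j; have := e j; rewrite !mxE => /intr_inj.
apply: inj; rewrite (raddfMn (map_mx intr : {additive 'rV[int]_n -> 'rV[rat]_n})).
rewrite /= bE QE -sumrMnl.
rewrite (raddf_sum (map_mx intr : {additive 'rV[int]_n -> 'rV[rat]_n})).
apply: eq_bigr => i _; rewrite scalerMnl zE scaler_int.
by rewrite -(raddfMz (map_mx intr : {additive 'rV[int]_n -> 'rV[rat]_n})).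
Qed.

End SublistSubgroup.

(** * Characters and components *)

(** A connected set containing $x<y$ is an interval, hence contains the infinitely many points
    $x+(y-x)/(k+1)$. *)
Lemma connected_finite_real (R : realType) (A : set R) :
  connected A -> finite_set A -> forall x y, A x -> A y -> x = y.
Proof.
move=> /connected_intervalP iA fA.
have ltF x y : A x -> A y -> ~ x < y.
  move=> Ax Ay xy; apply: infinite_nat.
  pose f (k : nat) := x + (y - x) / k.+1%:R.
  have -> : [set: nat] = f @^-1` A.
    apply/seteqP; split=> // k _; apply: (iA x y) => //.
    have d0 : 0 < y - x by rewrite subr_gt0.
    rewrite /f lerDl divr_ge0 ?(ltW d0) //= -lerBrDl.
    by rewrite ler_pdivrMr // ler_peMr ?(ltW d0) // ler1n.
  apply: finite_preimage fA => i j _ _ /addrI /mulfI.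
  have -> : y - x != 0 by rewrite subr_eq0 gt_eqF.
  by move=> /(_ isT) /invr_inj /eqP; rewrite eqr_nat => /eqP [].
move=> x y Ax Ay; have [/ltF|/ltF|] := ltgtP x y => //; tauto.
Qed.

Section Characters.
Variables (n : nat) (Gt : finZmodType) (R : realType) (X : seq (Lam n)).
Implicit Types (S : {set 'I_(size X)}) (t : TT n Gt R) (g : Gam n Gt).

Lemma torus0 t : torus t -> t 0 = (1, 0).
Proof.
move=> [nz tD]; have [w wE] := cexp_surj (nz 0).
rewrite -cexp0; apply: (@cmul_cexpI _ w).
by rewrite -cexpD addr0 -wE -tD addr0.
Qed.

(** Logarithms [w] of the values on [u] linearise the evaluation of a character; any choice of them
    will do. *)
Lemma torus_sum t (I : finType) (u : I -> Gam n Gt) (w : I -> R * R) (a : I -> int) :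
  torus t -> (forall j, t (u j) = cexp (w j)) ->
  t (\sum_j u j *~ a j) = cexp (\sum_j w j *~ a j).
Proof.
move=> tt tu; have t0 := torus0 tt; case: tt => nz tD.
apply: (big_ind2 (fun g v => t g = cexp v)); first by rewrite t0 cexp0.
  by move=> g v g' v' e e'; rewrite tD e e' cexpD.
move=> j _; have N (k : nat) : t (u j *+ k) = cexp (w j *+ k).
  elim: k => [|k IH]; first by rewrite !mulr0n t0 cexp0.
  by rewrite !mulrS tD IH tu cexpD.
case: (a j) => k; first exact: N.
rewrite NegzE !mulrNz; apply: (@cmul_cexpI _ (w j *+ k.+1)).
by rewrite -cexpD -[in LHS]N -tD !subrr t0 cexp0.
Qed.

Lemma torus_mulrn t g w (m : nat) : torus t -> t g = cexp w ->
  t (g *+ m) = cexp (w *+ m).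
Proof.
move=> tt tg.
have := @torus_sum t 'I_1 (fun=> g) (fun=> w) (fun=> m%:Z) tt (fun=> tg).
by rewrite !big_ord1.
Qed.

Lemma HA_genA S t g : HA S t -> genA S g -> t g = (1, 0).
Proof.
move=> [tt tX] [g2 [c cE]].
(* Zero coefficients outside [S] turn this into a sum over all indices, as [torus_sum] expects. *)
have -> : g = \sum_(i < size X) ((X`_i, 0) : Gam n Gt) *~ (if i \in S then c i else 0).
  rewrite [g]surjective_pairing g2 cE.
  rewrite [RHS]surjective_pairing.
  rewrite (raddf_sum (fst : {additive Gam n Gt -> Lam n})).
  rewrite (raddf_sum (snd : {additive Gam n Gt -> Gt})).
  congr pair.
    rewrite big_mkcond; apply: eq_bigr => i _.
    by rewrite (raddfMz (fst : {additive Gam n Gt -> Lam n})) /=; case: ifP; rewrite ?mulr0z.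
  rewrite big1 // => i _.
  by rewrite (raddfMz (snd : {additive Gam n Gt -> Gt})) /= mul0rz.
have [w wE] := choice (fun i : 'I_(size X) => cexp_surj (tt.1 (X`_i, 0))).
rewrite (torus_sum _ tt wE) -cexp0.
elim/big_ind: _ => // [v v' e e'|i _]; first by rewrite cexpD e e' -cexpD addr0.
case: ifP => iS; last by rewrite mulr0z.
have wi : cexp (w i) = (1, 0) by rewrite -wE tX.
case/cexp_eq1: wi => k ->; rewrite cexp0; apply/cexp_eq1; exists (k * c i).
rewrite [LHS]surjective_pairing.
rewrite (raddfMz (fst : {additive R * R -> R})) (raddfMz (snd : {additive R * R -> R})) /=.
by rewrite mul0rz mulrzA.
Qed.

Lemma proj_TT_continuous g : continuous (fun t : TT n Gt R => t g).
Proof. exact: (@proj_continuous (Gam n Gt) (fun=> ((R * R)%type : topologicalType)) g). Qed.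

Lemma ptws_continuous (f : R -> TT n Gt R) :
  (forall g, continuous (fun s => f s g)) -> continuous f.
Proof.
move=> fc x; apply/cvg_sup => g.
move=> U [V [[W oW <-] Wfx] VU].
apply: (@filterS _ _ _ _ _ VU).
have := fc g x; apply; exact: open_nbhs_nbhs.
Qed.

(** The path $s\mapsto t\exp(s\varphi)$ on $[0,1]$ joins the two points. It consists of characters
    because [phi] is additive, and stays in [HA S] because [phi] vanishes on the sublist. *)
Lemma HA_path S t (phi : Gam n Gt -> R * R) :
  HA S t -> (forall g h, phi (g + h) = phi g + phi h) ->
  (forall i, i \in S -> phi (X`_i, 0) = 0) ->
  connected_component (HA S) t (fun g => cmul (t g) (cexp (phi g))).
Proof.
move=> [[nz tD] tX] pD pX.
have c00 : cexp ((0 : R), (0 : R)) = (1, 0) := cexp0 R.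
pose f (s : R) : TT n Gt R := fun g => cmul (t g) (cexp (s * (phi g).1, s * (phi g).2)).
have f0 : f 0 = t.
  by apply/funext => g; rewrite /f !mul0r c00 cmul1.
have f1 : f 1 = (fun g => cmul (t g) (cexp (phi g))).
  by apply/funext => g; rewrite /f !mul1r -surjective_pairing.
have fH s : HA S (f s).
  split; last by move=> i iS; rewrite /f tX // pX //= !mulr0 c00 cmul1.
  split=> [g|g h]; rewrite /f.
    have [w ->] := cexp_surj (nz g).
    by rewrite -cexpD; exact: cexp_neq0.
  have [w wE] := cexp_surj (nz g); have [w' wE'] := cexp_surj (nz h).
  rewrite tD pD wE wE' -!cexpD; congr cexp.
  rewrite /= !mulrDr addrACA; congr (_ + _).
rewrite -f1; exists (f @` `[0, 1]); last by exists 1 => //=; rewrite in_itv /= ler01 lexx.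
split; first by exists 0 => //=; rewrite in_itv /= ler01 lexx.
  by move=> _ [s _ <-].
apply: connected_continuous_connected; first exact: segment_connected.
apply: continuous_subspaceT; apply: ptws_continuous => g s.
have c1 : (fun s => expR (s * (phi g).1)) @ s --> expR (s * (phi g).1).
  apply: continuous_comp; first exact: mulrr_continuous.
  exact: continuous_expR.
have m2 : (fun s => s * (phi g).2) @ s --> s * (phi g).2 by exact: mulrr_continuous.
have c2 : (fun s => cos (s * (phi g).2)) @ s --> cos (s * (phi g).2).
  apply: (continuous_comp m2); exact: continuous_cos.
have c3 : (fun s => sin (s * (phi g).2)) @ s --> sin (s * (phi g).2).
  apply: (continuous_comp m2); exact: continuous_sin.
set e := fun s => expR (s * (phi g).1) in c1.
set c := fun s => cos (s * (phi g).2) in c2.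
set d := fun s => sin (s * (phi g).2) in c3.
have h1 : (fun s => (t g).1 * (e s * c s) - (t g).2 * (e s * d s)) @ s -->
    (t g).1 * (e s * c s) - (t g).2 * (e s * d s).
  by apply: cvgB; apply: cvgM; [exact: cvg_cst|apply: cvgM|exact: cvg_cst|apply: cvgM].
have h2 : (fun s => (t g).1 * (e s * d s) + (t g).2 * (e s * c s)) @ s -->
    (t g).1 * (e s * d s) + (t g).2 * (e s * c s).
  by apply: cvgD; apply: cvgM; [exact: cvg_cst|apply: cvgM|exact: cvg_cst|apply: cvgM].
exact: (cvg_pair h1 h2).
Qed.

(** Some [g *+ m] lies in [genA S], so every point of [HA S] takes an $m$-th root of unity at [g].
    Evaluation at [g] is continuous with finitely many values, hence constant on a component. *)
Lemma component_GammaA S t t' g : HA S t -> connected_component (HA S) t t' ->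
  GammaA R S g -> t g = t' g.
Proof.
move=> Ht Ct' /GammaA_torsion[m m0 gm].
set C := connected_component (HA S) t in Ct'.
have Ct : C t by apply: connected_component_refl.
have CH : C `<=` HA S by apply: connected_component_sub.
have mN : m%:R != 0 :> R by rewrite pnatr_eq0 -lt0n.
pose z (k : nat) : R * R := cexp (0, (pi *+ 2) *+ k / m%:R).
have val s : C s -> exists2 k, (k < m)%N & s g = z k.
  move=> /CH Hs; have [w wE] := cexp_surj (Hs.1.1 g).
  have := HA_genA Hs gm; rewrite (torus_mulrn _ Hs.1 wE) => /cexp_eq1[k kE].
  have w1 : w.1 = 0.
    have := congr1 fst kE; rewrite (raddfMn (fst : {additive R * R -> R})) /=.
    by move=> /eqP; rewrite mulrn_eq0 eqn0Ngt m0 /= => /eqP.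
  have w2 : w.2 = (pi *+ 2) *~ k / m%:R.
    have := congr1 snd kE; rewrite (raddfMn (snd : {additive R * R -> R})) /=.
    by rewrite -[_ *+ m]mulr_natr => <-; rewrite mulfK.
  have mz : (m%:Z != 0) by case: (m) m0.
  exists `|(k %% m%:Z)%Z|%N.
    by rewrite -ltz_nat gez0_abs ?modz_ge0 // ltz_pmod // ltz_nat.
  rewrite wE; apply/cexp_eq/cexp_eq1; exists (k %/ m%:Z)%Z.
  rewrite [w]surjective_pairing w1 w2; congr pair; first by rewrite /= subrr.
  have kr : 0 <= (k %% m%:Z)%Z by rewrite modz_ge0.
  move: (pi *+ 2) => q /=.
  have -> : q *+ `|(k %% m%:Z)%Z|%N = q *~ (k %% m%:Z)%Z.
    by rewrite -[in RHS](gez0_abs kr).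
  have -> : q *~ k = q *~ (k %/ m%:Z)%Z * m%:R + q *~ (k %% m%:Z)%Z.
    rewrite mulr_natr pmulrn -mulrzA -mulrzDr; congr (_ *~ _).
    exact: divz_eq.
  by rewrite mulrDl addrK mulfK.
(* Real and imaginary parts are treated one at a time, to fall under [connected_finite_real]. *)
have proj (p : R * R -> R) : continuous p -> p (t g) = p (t' g).
  move=> pc; pose q (s : TT n Gt R) := p (s g).
  apply: (@connected_finite_real R (q @` C)).
  - apply: connected_continuous_connected; first exact: component_connected.
    apply: continuous_subspaceT => s.
    apply: (@continuous_comp _ _ _ (fun s : TT n Gt R => s g) p); last exact: pc.
    exact: proj_TT_continuous.
  - apply: (@sub_finite_set _ _ ((fun k => p (z k)) @` `I_m)).
      by move=> _ [s /val[k km e] <-]; exists k => //; rewrite /q e.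
    by apply: finite_image; exact: finite_II.
  - by exists t.
  - by exists t'.
rewrite [LHS]surjective_pairing [RHS]surjective_pairing.
by congr pair; apply: proj => x; [exact: cvg_fst|exact: cvg_snd].
Qed.

End Characters.

(** A common index set for the cosets of [genA S] in [GammaA R S] and for the components of
    [HA S]. *)
Lemma residue_box (N : nat) (d : 'I_N -> nat) :
  exists (B : finType) (v : B -> 'I_N -> nat),
    [/\ forall b b', (forall j, (d j %| (v b j)%:Z - (v b' j)%:Z)%Z) -> b = b',
        forall b j, d j = 0%N -> v b j = 0%N &
        forall k : 'I_N -> int, exists b, forall j, (0 < d j)%N ->
          (d j %| k j - (v b j)%:Z)%Z].
Proof.
(* The bound [maxn (d j) 1] allows only the value 0 where [d j] is 0. *)
pose P (b : {ffun 'I_N -> 'I_(\max_j d j).+1}) := [forall j, (b j < maxn (d j) 1)%N].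
exists {b | P b}, (fun (b : {b | P b}) j => nat_of_ord (sval b j)); split.
- move=> [b Pb] [b' Pb'] /= dv; apply: val_inj => /=; apply/ffunP => j.
  have /forallP/(_ j) lb := Pb; have /forallP/(_ j) lb' := Pb'.
  apply: val_inj => /=; have := dv j; have [d0|dp] := posnP (d j).
    by move: lb lb'; rewrite d0; lia.
  rewrite -eqz_mod_dvd !modz_nat => /eqP [].
  move: lb lb'; rewrite (maxn_idPl dp) => lb lb'; by rewrite !modn_small.
- move=> [b Pb] j d0 /=; have /forallP/(_ j) := Pb; by rewrite d0 max0n ltnS leqn0 => /eqP.
- move=> k; pose r j := if d j == 0%N then 0%N else `|(k j %% d j)%Z|%N.
  have rl j : (r j < maxn (d j) 1)%N.
    rewrite /r; have [->|dp] := posnP (d j); first by rewrite leq_max orbT.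
    have dN : (d j)%:Z != 0 by case: (d j) dp.
    rewrite leq_max -ltz_nat gez0_abs ?modz_ge0 //.
    by rewrite ltz_pmod.
  have rM j : (r j < (\max_j d j).+1)%N.
    apply: leq_trans (rl j) _; rewrite geq_max andbT.
    by apply: leqW; apply: (leq_bigmax j).
  pose b := [ffun j => Ordinal (rM j)].
  have Pb : P b by apply/forallP => j; rewrite ffunE; exact: rl.
  exists (exist _ b Pb) => j dp /=; rewrite ffunE /= /r gtn_eqF //.
  have dN : (d j)%:Z != 0 by case: (d j) dp.
  rewrite gez0_abs ?modz_ge0 //; apply/dvdzP; exists (k j %/ d j)%Z.
  by rewrite {1}(divz_eq (k j) (d j)) addrK.
Qed.

(** * Coordinates adapted to a sublist, and components of its zero locus *)

Section Components.
Variables (n : nat) (Gt : finZmodType) (R : realType) (X : seq (Lam n)).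
Variable S : {set 'I_(size X)}.

(** Send each representative in one list to a congruent one in the other; two with the same image
    would be congruent, so the map is injective. *)
Lemma is_index_unique (H K : set (Gam n Gt)) k k' :
  (forall g h, K g -> K h -> K (g - h)) ->
  is_index H K k -> is_index H K k' -> k = k'.
Proof.
move=> KB.
suff le k1 k2 : is_index H K k1 -> is_index H K k2 -> (k1 <= k2)%N.
  by move=> h h'; apply/eqP; rewrite eqn_leq !le.
move=> [s [sk sH sK _]] [s' [sk' _ _ s'c]].
have f (i : 'I_k1) : exists j : 'I_k2, K (nth 0 s i - nth 0 s' j).
  have [|g gs Kg] := s'c (nth 0 s i); first by apply: sH; rewrite mem_nth ?sk.
  have gk : (index g s' < k2)%N by rewrite -sk' index_mem.
  by exists (Ordinal gk); rewrite /= nth_index.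
have [F FE] := choice f.
rewrite -(card_ord k1) -(card_ord k2); apply: (@leq_card _ _ F) => i j e.
apply: val_inj; apply: contrapT => ij; apply: (sK i j) => //.
by have := KB _ _ (FE i) (FE j); rewrite e opprB addrA subrK.
Qed.

Variables (N : nat) (u : 'I_N -> Gam n Gt) (d : 'I_N -> nat).
Hypothesis gen : forall g, exists a : 'I_N -> int, g = \sum_j u j *~ a j.
Hypothesis genAP : forall a : 'I_N -> int,
  genA S (\sum_j u j *~ a j) <-> forall j, (d j %| a j)%Z.

Lemma genA0 : genA S (0 : Gam n Gt).
Proof. by split=> //; exists (fun=> 0); rewrite big1 // => i _; rewrite mulr0z. Qed.

Lemma GammaA_coord (a : 'I_N -> int) j :
  GammaA R S (\sum_j u j *~ a j) -> d j = 0%N -> a j = 0.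
Proof.
move=> /GammaA_torsion[m m0]; rewrite pmulrn mulrz_suml.
under eq_bigr do rewrite -mulrzA.
move=> /genAP/(_ j) + d0; rewrite d0 dvd0z mulf_eq0 => /orP[/eqP //|].
by case: (m) m0.
Qed.

(** The product of the nonzero divisors is a multiplier that carries the element into [genA S]. *)
Lemma GammaA_comb (a : 'I_N -> int) :
  (forall j, d j = 0%N -> a j = 0) -> GammaA R S (\sum_j u j *~ a j).
Proof.
move=> a0; apply/GammaA_torsion.
exists (\prod_(j | (0 < d j)%N) d j)%N; first exact: prodn_cond_gt0.
set m := (\prod_(j | _) _)%N.
rewrite pmulrn mulrz_suml; under eq_bigr do rewrite -mulrzA.
apply/genAP => j; have [d0|dp] := posnP (d j).
  by rewrite a0 // mul0r dvdz0.
by rewrite /m (bigD1 j) //= PoszM mulrCA dvdz_mulr.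
Qed.

Lemma sum_pick (V : zmodType) (v : 'I_N -> V) j :
  \sum_k v k *~ (k == j)%:Z = v j.
Proof.
rewrite (bigD1 j) //= eqxx big1 ?addr0 // => k /negbTE ->.
by rewrite mulr0z.
Qed.

Lemma GammaA_generator j : (0 < d j)%N -> GammaA R S (u j).
Proof.
move=> dp; rewrite -(sum_pick u); apply: GammaA_comb => k d0.
by case: eqP => // kj; move: dp; rewrite -kj d0.
Qed.

(** The coordinates of an element need not be unique, but two choices differ by coordinates of 0,
    which lies in [genA S]. *)
Lemma coord_dvd (a a' : 'I_N -> int) j :
  \sum_j u j *~ a j = \sum_j u j *~ a' j -> (d j %| a j - a' j)%Z.
Proof.
move=> e; have : genA S (\sum_j u j *~ (a j - a' j)).
  under eq_bigr do rewrite mulrzBr.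
  by rewrite sumrB e subrr; exact: genA0.
by move/genAP/(_ j).
Qed.

Lemma cexp_sum1 (w : 'I_N -> R * R) :
  (forall j, cexp (w j) = (1, 0)) -> cexp (\sum_j w j) = (1, 0).
Proof.
move=> w1; elim/big_ind: _ => //; first exact: cexp0.
by move=> x y ex ey; rewrite cexpD ex ey cmul1.
Qed.

(** The hypothesis makes [cexp (w j *~ x)] depend on [x] modulo [d j] only, which is exactly the
    ambiguity of coordinates left by [coord_dvd]. *)
Lemma HA_of_weights (w : 'I_N -> R * R) :
  (forall j (x : int), (d j %| x)%Z -> cexp (w j *~ x) = (1, 0)) ->
  exists t : TT n Gt R, HA S t /\
    forall a : 'I_N -> int, t (\sum_j u j *~ a j) = cexp (\sum_j w j *~ a j).
Proof.
move=> w1; have [a aE] := choice gen.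
have wd (b b' : 'I_N -> int) : (forall j, (d j %| b j - b' j)%Z) ->
    cexp (\sum_j w j *~ b j) = cexp (\sum_j w j *~ b' j).
  move=> dv; apply/cexp_eq; rewrite -sumrB; apply: cexp_sum1 => j.
  by rewrite -mulrzBr w1.
exists (fun g => cexp (\sum_j w j *~ a g j)); split; last first.
  by move=> b; apply: wd => j; apply: coord_dvd; rewrite -aE.
split; first split.
- by move=> g; exact: cexp_neq0.
- move=> g h; rewrite -cexpD -big_split /=.
  under [in RHS]eq_bigr do rewrite -mulrzDr.
  apply: (wd _ (fun j => a g j + a h j)) => j.
  apply: (@coord_dvd (a (g + h)) (fun j => a g j + a h j)); rewrite -aE.
  under eq_bigr do rewrite mulrzDr.
  by rewrite big_split /= -!aE.
- move=> i iS; apply: (@cexp_sum1 (fun j => w j *~ a (X`_i, 0) j)) => j; apply: w1; move: j.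
  apply/(genAP (a (X`_i, 0))); rewrite -aE; split=> //.
  exists (fun k => (k == i)%:Z); rewrite (bigD1 i) //= eqxx big1 ?addr0 //.
  by move=> k /andP[_ /negbTE ->]; rewrite mulr0z.
Qed.

(** The points differ only on the [u j] with [d j = 0]. There the coordinates are unique, so the
    difference of logarithms extends to an additive [phi], and [HA_path] applies. *)
Lemma component_of_agree (t t' : TT n Gt R) : HA S t -> HA S t' ->
  (forall g, GammaA R S g -> t g = t' g) -> connected_component (HA S) t t'.
Proof.
move=> Ht Ht' tt'; have [a aE] := choice gen.
have [w wE] := choice (fun j => cexp_surj (Ht.1.1 (u j))).
have [w' w'E] := choice (fun j => cexp_surj (Ht'.1.1 (u j))).
pose e j := if d j == 0%N then w' j - w j else 0.
have t'E j : t' (u j) = cexp (w j + e j).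
  rewrite /e; case: (posnP (d j)) => [d0|dp]; first by rewrite addrC subrK.
  by rewrite addr0 -wE tt' //; exact: GammaA_generator.
pose phi g := \sum_j e j *~ a g j.
have e0 (b b' : 'I_N -> int) : (forall j, (d j %| b j - b' j)%Z) ->
    \sum_j e j *~ b j = \sum_j e j *~ b' j.
  move=> dv; apply: eq_bigr => j _; rewrite /e; case: eqP => [d0|_]; last by rewrite !mul0rz.
  by have := dv j; rewrite d0 dvd0z subr_eq0 => /eqP ->.
have -> : t' = (fun g => cmul (t g) (cexp (phi g))).
  apply/funext => g; rewrite {1 2}(aE g).
  rewrite (torus_sum _ Ht.1 wE) (torus_sum _ Ht'.1 t'E) -cexpD -big_split /=.
  by congr cexp; apply: eq_bigr => j _; rewrite mulrzDl.
apply: HA_path => // [g h|i iS].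
  rewrite /phi -big_split /=; under [RHS]eq_bigr do rewrite -mulrzDr.
  apply: (e0 _ (fun j => a g j + a h j)) => j.
  apply: (@coord_dvd (a (g + h)) (fun j => a g j + a h j)); rewrite -aE.
  under eq_bigr do rewrite mulrzDr.
  by rewrite big_split /= -!aE.
rewrite /phi (e0 _ (fun=> 0)) => [|j]; first by rewrite big1 // => j _; rewrite mulr0z.
rewrite subr0; move: j; apply/(genAP (a (X`_i, 0))); rewrite -aE; split=> //.
exists (fun k => (k == i)%:Z); rewrite (bigD1 i) //= eqxx big1 ?addr0 //.
by move=> k /andP[_ /negbTE ->]; rewrite mulr0z.
Qed.

End Components.

(** * The number of components equals the multiplicity *)

Section Counting.
Variables (n : nat) (Gt : finZmodType) (R : realType) (X : seq (Lam n)).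
Variable S : {set 'I_(size X)}.

Lemma mult_is_index k : is_index (GammaA R S) (@genA n Gt X S) k -> mult Gt R S = k.
Proof.
move=> ik; apply: xget_unique => // k' ik'.
by apply: is_index_unique ik' ik => g h; exact: genA_sub.
Qed.

Lemma mult_comps : exists (B : finType) (C : B -> set (TT n Gt R)),
  [/\ mult Gt R S = #|B|, injective C & comps S = range C].
Proof.
have [N [u [d [gen genAP]]]] := @genA_elementary_divisors n Gt X S.
have [B [v [v_inj v0 vc]]] := residue_box d.
have diffE (V : zmodType) (x : 'I_N -> V) (a b : 'I_N -> int) :
    \sum_j x j *~ a j - \sum_j x j *~ b j = \sum_j x j *~ (a j - b j).
  by rewrite -sumrB; apply: eq_bigr => j _; rewrite mulrzBr.
pose r (b : B) := \sum_j u j *~ (v b j)%:Z.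
have rG b : GammaA R S (r b).
  by apply: (@GammaA_comb _ _ _ _ _ _ _ _ genAP (fun j => (v b j)%:Z)) => j /v0 ->.
have r_inj b b' : genA S (r b - r b') -> b = b'.
  by rewrite diffE => /genAP; exact: v_inj.
have rc h : GammaA R S h -> exists b, genA S (h - r b).
  have [a ->] := gen h => Ha; have [b bE] := vc a; exists b.
  rewrite diffE; apply/genAP => j; have [d0|dp] := posnP (d j); last exact: bE.
  by rewrite (GammaA_coord genAP Ha d0) v0 // subrr dvdz0.
pose p : R := pi *+ 2.
(* Logarithm of $\exp(2\pi i v_j/d_j)$. If [d j = 0], then [v b j = 0] and the quotient is 0, so the
   value on [u j] is 1. *)
pose th b j : R * R := (0, p *+ v b j / (d j)%:R).
have thZ b j (x : int) : th b j *~ x = (0, p *+ v b j / (d j)%:R *~ x).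
  rewrite [LHS]surjective_pairing.
  rewrite (raddfMz (fst : {additive R * R -> R})) (raddfMz (snd : {additive R * R -> R})) /=.
  by rewrite mul0rz.
have th1 b j x : (d j %| x)%Z -> cexp (th b j *~ x) = (1, 0).
  move=> dv; apply/cexp_eq1; rewrite thZ; have [d0|dp] := posnP (d j).
    move: dv; rewrite d0 dvd0z => /eqP ->; exists 0.
    by rewrite !mulr0z.
  have [y ->] := dvdzP dv; exists ((v b j)%:Z * y); congr pair.
  rewrite -/p; move: (p) => q.
  have dN : (d j)%:R != 0 :> R by rewrite pnatr_eq0 -lt0n.
  rewrite -[q *+ _]mulr_natr -[LHS]mulrzr -[RHS]mulrzr !intrM -!pmulrn; by field.
have [t tE] := choice (fun b => HA_of_weights gen genAP (th1 b)).
have t_u b j : t b (u j) = cexp (th b j).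
  by rewrite -(sum_pick u) (tE b).2 sum_pick.
pose C b := connected_component (HA S) (t b).
exists B, C; split.
- apply: mult_is_index; exists [seq r b | b <- enum B]; split.
  + by rewrite size_map -cardE.
  + by move=> _ /mapP[b _ ->].
  + move=> i j iB jB ij.
    have {}iB : (i < size (enum B))%N by rewrite -cardE.
    have {}jB : (j < size (enum B))%N by rewrite -cardE.
    have [b0 _] : exists b0 : B, true by case: (enum B) iB => // b0; exists b0.
    rewrite (nth_map b0 _ _ iB) (nth_map b0 _ _ jB) => /r_inj /eqP.
    by rewrite nth_uniq ?enum_uniq // => /eqP.
  + move=> h /rc[b bE]; exists (r b) => //.
    by apply/mapP; exists b => //; rewrite mem_enum.
- move=> b b' CE; apply: v_inj => j; have [d0|dp] := posnP (d j).
    by rewrite !v0 // subrr dvdz0.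
  (* Points of one component agree on [u j], which lies in [GammaA R S] as [d j] is positive; equal
     roots of unity then have exponents congruent modulo [d j]. *)
  have : C b (t b') by rewrite CE; apply: connected_component_refl; exact: (tE b').1.
  move=> /(component_GammaA (tE b).1) /(_ (GammaA_generator R genAP dp)).
  rewrite !t_u => /cexp_eq/cexp_eq1[k]; rewrite /th => -[_ kE].
  apply/dvdzP; exists k; apply: (@intr_inj R).
  have pN : p != 0 by rewrite mulrn_eq0 /= gt_eqF // pi_gt0.
  have dN : (d j)%:R != 0 :> R by rewrite pnatr_eq0 -lt0n.
  move: kE pN; rewrite -/p; move: (p) => q kE qN.
  apply: (mulfI qN); rewrite intrB intrM -!pmulrn.
  transitivity ((q *+ v b j / (d j)%:R - q *+ v b' j / (d j)%:R) * (d j)%:R).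
    by rewrite mulrBl !divfK // mulrBr !mulr_natr.
  by rewrite [X in X * _]kE -mulrzr mulrA.
- apply/seteqP; split=> [_ [s Hs <-]|_ [b _ <-]]; last by exists (t b) => //; exact: (tE b).1.
  have [w wE] := choice (fun j => cexp_surj (Hs.1.1 (u j))).
  (* [u j *+ d j] lies in [genA S], so [s] takes a [d j]-th root of unity at [u j]; the residues of
     the exponents [k] pick the index [b]. *)
  have kE j : exists k : int, (0 < d j)%N -> w j = (0, p *~ k / (d j)%:R).
    have [d0|dp] := posnP (d j); first by exists 0.
    have gj : genA S (u j *+ d j).
      rewrite pmulrn -(sum_pick u j) mulrz_suml.
      under eq_bigr do rewrite -mulrzA.
      by apply/genAP => i; case: eqP => [->|_]; rewrite ?mul1r ?mul0r ?dvdz0.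
    have := HA_genA Hs gj; rewrite (torus_mulrn _ Hs.1 (wE j)) => /cexp_eq1[k].
    rewrite -/p => kE; exists k => _.
    have := congr1 fst kE; have := congr1 snd kE.
    rewrite (raddfMn (fst : {additive R * R -> R})) (raddfMn (snd : {additive R * R -> R})) /=.
    move=> <- /eqP; rewrite mulrn_eq0 eqn0Ngt dp /= => /eqP w0.
    rewrite [w j]surjective_pairing w0; congr pair.
    by rewrite /= -[_ *+ d j]mulr_natr mulfK // pnatr_eq0 -lt0n.
  have [k {}kE] := choice kE; have [b bE] := vc k.
  exists b => //; apply: same_connected_component.
  apply: (component_of_agree gen genAP (tE b).1 Hs) => g Hg.
  have [a aE] := gen g; rewrite aE in Hg *.
  rewrite (tE b).2 (torus_sum _ Hs.1 wE); apply/cexp_eq.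
  rewrite -sumrB; apply: cexp_sum1 => j.
  have [d0|dp] := posnP (d j).
    by rewrite (GammaA_coord genAP Hg d0) !mulr0z subrr cexp0.
  have /dvdzP[y yE] := bE j dp.
  apply/cexp_eq1; exists (- y * a j).
  rewrite -mulrzBl kE // /th.
  have -> : (0, p *+ v b j / (d j)%:R) - (0, p *~ k j / (d j)%:R) = (0, p *~ (- y)) :> R * R.
    congr pair; first by rewrite /= subrr.
    have dN : (d j)%:R != 0 :> R by rewrite pnatr_eq0 -lt0n.
    rewrite /= -mulrBl; apply: (canLR (mulfK dN)).
    move: (p) => q; rewrite pmulrn -mulrzBr.
    have -> : (v b j)%:Z - k j = - y * (d j)%:Z by rewrite -opprB yE mulNr.
    by rewrite mulrzA -pmulrn mulr_natr.
  rewrite [LHS]surjective_pairing.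
  rewrite (raddfMz (fst : {additive R * R -> R})) (raddfMz (snd : {additive R * R -> R})) /=.
  by rewrite mul0rz mulrzA.
Qed.

End Counting.

(** * Dimension and rank *)

Section Dimension.
Variables (n : nat) (Gt : finZmodType) (R : realType) (X : seq (Lam n)).
Implicit Types (S : {set 'I_(size X)}) (C : set (TT n Gt R)).

Definition pairing (l : Lam n) (a : 'rV[R]_n) : R := \sum_(j < n) (l 0 j)%:~R * a 0 j.

Lemma pairingD l l' a : pairing (l + l') a = pairing l a + pairing l' a.
Proof.
by rewrite /pairing -big_split; apply: eq_bigr => j _; rewrite mxE intrD mulrDl.
Qed.

Lemma expdir_component S t (V : 'rV[R]_(n + n)) s : @HA n Gt R X S t ->
  (forall i : 'I_(size X), i \in S ->
     pairing X`_i (lsubmx V) = 0 /\ pairing X`_i (rsubmx V) = 0) ->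
  connected_component (HA S) t (fun g => cmul (t g) (expdir V s g)).
Proof.
move=> Ht VS.
apply: (@HA_path _ _ _ _ S t
  (fun g => (s * pairing g.1 (lsubmx V), s * pairing g.1 (rsubmx V)))) => //.
  by move=> g h; rewrite !pairingD !mulrDr.
by move=> i iS; have [-> ->] := VS i iS; rewrite !mulr0.
Qed.

(** If the flow of [V] preserves [C], then $s\langle\chi_i,V\rangle\in 2\pi i\mathbb{Z}$ for every
    real $s$, which forces the pairing to vanish. *)
Lemma lie_comps S C V : comps S C ->
  (lie C V <-> forall i : 'I_(size X), i \in S ->
     pairing X`_i (lsubmx V) = 0 /\ pairing X`_i (rsubmx V) = 0).
Proof.
move=> [t0 Ht0 <-]; split=> [LV i iS|VS s t Ct]; last first.
  rewrite (same_connected_component Ct); apply: expdir_component => //.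
  exact: connected_component_sub Ct.
have ex (s : R) : exists k : int, (s * pairing X`_i (lsubmx V), s * pairing X`_i (rsubmx V))
    = (0, (pi *+ 2) *~ k) :> R * R.
  apply/cexp_eq1; have := LV s t0 (connected_component_refl Ht0).
  move=> /connected_component_sub [_ /(_ i iS)].
  by rewrite (Ht0.2 i iS) cmulC cmul1.
have [k1 []] := ex 1; rewrite mul1r => -> _; split=> //.
apply/eqP/negPn/negP => bN.
(* At this $s$ the imaginary part is $\pi$, so $\pi=2\pi k$, impossible by parity. *)
have [k []] := ex (pi / pairing X`_i (rsubmx V)); rewrite divfK // => _.
have : (pi : R) != 0 by rewrite gt_eqF // pi_gt0.
move: (pi : R) => q qN; rewrite -mulrzr -mulr_natr -mulrA -{1}[q]mulr1.
move=> /(mulfI qN)/eqP; rewrite -(intrM _ 2 k) (eqr_int _ 1).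
by move=> /eqP; lia.
Qed.

Definition char_mx S : 'M[R]_(size X, n) :=
  \matrix_(i < size X, j < n) (if i \in S then (X`_i 0 j)%:~R else 0 : R).

Lemma lie_compsE S C V : comps S C ->
  lie C V <-> V *m block_mx (char_mx S)^T 0 0 (char_mx S)^T = 0.
Proof.
move=> CS; rewrite (lie_comps V CS) -{3}[V]hsubmxK mul_row_block !mulmx0 addr0 add0r.
have e (a : 'rV[R]_n) i : (a *m (char_mx S)^T) 0 i = if i \in S then pairing X`_i a else 0.
  rewrite mxE; case: ifP => iS.
    by apply: eq_bigr => j _; rewrite !mxE iS mulrC.
  by rewrite big1 // => j _; rewrite !mxE iS mulr0.
split=> [VS|V0 i iS].
  rewrite -[RHS](row_mx0 _ _ (size X) (size X)) ; congr row_mx; apply/rowP => i; rewrite e mxE;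
    by case: ifP => // /VS[].
have [/rowP/(_ i) + /rowP/(_ i)] := eq_row_mx (etrans V0 (esym (row_mx0 _ _ _ _))).
by rewrite !e iS !mxE.
Qed.

(** By [lie_compsE] the Lie algebra is the kernel of a matrix of rank [rk R S + rk R S] in real
    dimension $2n$. A basis of that kernel attains the maximum in [realdim]. *)
Lemma cdim_comps S C : comps S C -> cdim C = (n - rk R S)%N.
Proof.
move=> CS; rewrite /cdim; set M := block_mx (char_mx S)^T 0 0 (char_mx S)^T.
have rM : \rank M = (rk R S + rk R S)%N by rewrite rank_diag_block_mx mxrank_tr.
have rn : (rk R S <= n)%N by rewrite rank_leq_col.
suff -> : realdim C = (n - rk R S).*2 by rewrite doubleK.
apply/eqP; rewrite eqn_leq; apply/andP; split.
  apply/bigmax_leqP => k /asboolP[B [fB lB]].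
  have : B *m M = 0.
    apply/row_matrixP => i; rewrite row_mul row0.
    by apply/(lie_compsE _ CS); exact: lB.
  by move=> /mulmx0_rank_max; rewrite rM (eqP fB); lia.
have kN : (\rank (kermx M) < (n + n).+1)%N by rewrite ltnS rank_leq_col.
have -> : (n - rk R S).*2 = nat_of_ord (Ordinal kN).
  by rewrite /= mxrank_ker rM; lia.
apply: (@leq_bigmax_cond _ _ (fun k : 'I_(n + n).+1 => nat_of_ord k)).
apply/asboolP; exists (row_base (kermx M)); split; first exact: row_base_free.
move=> i; apply/(lie_compsE _ CS); apply/sub_kermxP.
by apply: submx_trans (row_sub i _) _; rewrite eq_row_base.
Qed.

(** The matrix factors through its rows indexed by [S], the others being zero. *)
Lemma rk_le_card S : (rk R S <= #|S|)%N.
Proof.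
rewrite /rk; set M := (X in \rank X).
have -> : M = (\matrix_(i < size X, k < #|S|) (enum_val k == i)%:R)
    *m rowsub (fun k : 'I_#|S| => enum_val k) M.
  apply/row_matrixP => i; rewrite row_mul mulmx_sum_row.
  under eq_bigr => k _.
    rewrite !mxE row_rowsub. over.
  have [iS|iS] := boolP (i \in S).
    rewrite (bigD1 (enum_rank_in iS i)) //= enum_rankK_in // eqxx scale1r.
    rewrite big1 ?addr0 // => k ki; case: eqP => [e|_]; last by rewrite scale0r.
    by case/eqP: ki; apply: enum_val_inj; rewrite enum_rankK_in.
  rewrite big1 => [|k _].
    by apply/rowP => j; rewrite !mxE (negbTE iS).
  case: eqP => [e|_]; last by rewrite scale0r.
  by move: iS; rewrite -e enum_valP.
by apply: leq_trans (mxrankM_maxl _ _) _; rewrite rank_leq_col.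
Qed.

(** Pigeonhole: among the multiples of a basis vector two lie in the same coset, so a nonzero
    multiple of that vector is a combination of [X]. *)
Lemma rk_full :
  (exists s : seq (Lam n), forall l : Lam n,
      exists2 w, w \in s & exists c : 'I_(size X) -> int,
        l - w = \sum_(i < size X) X`_i *~ c i) ->
  rk R [set: 'I_(size X)] = n.
Proof.
move=> [s sP]; apply/eqP; rewrite /rk; set M := (X in \rank X).
suff : row_full M by [].
rewrite -sub1mx; apply/row_subP => j; rewrite rowE mulmx1.
(* One more multiple than there are coset representatives. *)
have f (k : 'I_(size s).+1) : exists i : 'I_(size s), exists c : 'I_(size X) -> int,
    (delta_mx 0 j : Lam n) *+ k - s`_i = \sum_(i < size X) X`_i *~ c i.
  have [w ws [c cE]] := sP ((delta_mx 0 j : Lam n) *+ k).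
  have wi : (index w s < size s)%N by rewrite index_mem.
  by exists (Ordinal wi), c; rewrite /= nth_index.
have [F FE] := choice f.
have /injectivePn[k [k' kk' Fkk']] : ~~ injectiveb F.
  by apply/negP => /injectiveP/leq_card; rewrite !card_ord ltnn.
have [c cE] := FE k; have [c' c'E] := FE k'.
have e : (delta_mx 0 j : Lam n) *~ (k%:Z - k'%:Z) = \sum_(i < size X) X`_i *~ (c i - c' i).
  transitivity ((delta_mx 0 j : Lam n) *+ k - s`_(F k) - (delta_mx 0 j *+ k' - s`_(F k'))).
    by rewrite Fkk' opprB addrA subrK mulrzBr.
  rewrite cE c'E -sumrB; apply: eq_bigr => i _; by rewrite mulrzBr.
have dN : (k%:Z - k'%:Z)%:~R != 0 :> R.
  rewrite intr_eq0 subr_eq0; apply: contra kk' => /eqP[] kE.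
  by apply/eqP/val_inj.
rewrite -(eqmx_scale _ dN); apply/submxP.
exists (\row_i (c i - c' i)%:~R); rewrite mulmx_sum_row.
apply/rowP => l; have /rowP/(_ l)/(congr1 (intr : int -> R)) := e.
have mzE (A : Lam n) (a : int) : (A *~ a) 0 l = A 0 l * a.
  by rewrite -scaler_int mxE intz mulrC.
rewrite mzE summxE intrM mulrC => eE.
rewrite [LHS]mxE [X in _ * X](_ : _ = ((delta_mx 0 j : Lam n) 0 l)%:~R); last first.
  by rewrite !mxE; case: (_ && _).
rewrite eE rmorph_sum summxE; apply: eq_bigr => i _.
rewrite /= mzE !mxE inE /= ?intrM; exact: mulrC.
Qed.

Lemma torus_component_nontrivial (t : TT n Gt R) (i : 'I_(size X)) :
  X`_i != 0 -> torus t ->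
  exists2 t', connected_component (@torus n Gt R) t t' & t' (X`_i, 0) <> (1, 0).
Proof.
move=> /eqP Xi tt.
have [j jN] : exists j, X`_i 0 j != 0.
  by apply: contrapT => h; apply: Xi; apply/rowP => j; rewrite mxE;
    apply/eqP/negPn/negP => ?; apply: h; exists j.
have HT : HA (finset.set0 : {set 'I_(size X)}) = @torus n Gt R.
  by apply/seteqP; split=> [t1 []//|t1 tt1]; split=> // k; rewrite inE.
have [t1|] := pselect (t (X`_i, 0) = (1, 0)); last first.
  by move=> h; exists t => //; apply: connected_component_refl.
(* A real direction changes the modulus: the value at [X]_i[becomes the exponential of the nonzero
   integer]X[_i 0 j]. *)
pose V : 'rV[R]_(n + n) := row_mx (delta_mx 0 j) 0.
exists (fun g => cmul (t g) (expdir V 1 g)).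
  rewrite -HT; apply: expdir_component; first by rewrite HT.
  by move=> k; rewrite inE.
rewrite t1 cmulC cmul1 => e.
have [k [+ _]] := iffLR (cexp_eq1 (1 * pairing X`_i (lsubmx V), 1 * pairing X`_i (rsubmx V))) e.
rewrite mul1r /pairing (bigD1 j) //= big1 => [|l lj]; last first.
  by rewrite row_mxKl mxE (negbTE lj) andbF mulr0.
by rewrite row_mxKl mxE !eqxx mulr1 addr0 => /eqP; rewrite intr_eq0 (negbTE jN).
Qed.

End Dimension.

(** * Layers and the Moebius function *)

(** Expand $\prod_i(1-[i\in A])$, which has a zero factor as soon as [A] is nonempty. *)
Lemma sum_sign_subsets (I : finType) (A : {set I}) :
  \sum_(S : {set I} | S \subset A) (-1) ^+ #|S| = (A == finset.set0)%:R :> int.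
Proof.
transitivity (\prod_i ((if i \in A then -1 else 0) + 1) : int); last first.
  case: (set_0Vmem A) => [->|[i iA]].
    by rewrite eqxx big1 // => i _; rewrite inE add0r.
  rewrite (bigD1 i) //= iA addNr mul0r; case: eqP iA => // ->.
  by rewrite inE.
rewrite bigA_distr big_mkcond /=; apply: eq_bigr => S _.
case: ifPn => [SA|/fintype.subsetPn[i iS iA]].
  rewrite -big_mkcond /= -prodr_const; apply: eq_bigr => i iS.
  by rewrite (fintype.subsetP SA).
by rewrite (bigD1 i) //= iS (negbTE iA) mul0r.
Qed.

Section Layers.
Variables (n : nat) (Gt : finZmodType) (R : realType) (X : seq (Lam n)).
Implicit Types (S : {set 'I_(size X)}) (C z : set (TT n Gt R)).
Let L := @layers n Gt R X.

Lemma HA_set0 : @HA n Gt R X finset.set0 = @torus n Gt R.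
Proof. by apply/seteqP; split=> [t []//|t tt]; split=> // k; rewrite inE. Qed.

Lemma comps_fsbig (V : zmodType) (a : V) S :
  \sum_(z \in L) (if `[< comps S z >] then a else 0) = a *+ mult Gt R S.
Proof.
have [B [F [-> F_inj FE]]] := @mult_comps n Gt R X S.
transitivity (\sum_(z \in L `&` comps S) a).
  rewrite fsbig_mkcondr; apply: eq_fsbigr => z _.
  by rewrite -[z \in comps S]/(`[< comps S z >]).
have -> : L `&` comps S = [set` [seq F b | b <- enum B]].
  rewrite FE; apply/seteqP; split=> [z [_ [b _ <-]]|z /mapP[b _ ->]] /=.
    by apply/mapP; exists b => //; rewrite mem_enum.
  by split; [exists S; rewrite FE; exists b|exists b].
rewrite -fsbig_seq ?map_inj_uniq //.
  by rewrite big_map big_enum sumr_const.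
by rewrite -enumT enum_uniq.
Qed.

Lemma layers_finite : finite_set L.
Proof.
have -> : L = \bigcup_(S in [set: {set 'I_(size X)}]) comps S.
  by apply/seteqP; split=> [z [S Sz]|z [S _ Sz]]; exists S.
apply: bigcup_finite => [|S _]; first exact: finite_finset.
have [B [F [_ _ ->]]] := @mult_comps n Gt R X S.
by apply: finite_image; exact: finite_finset.
Qed.

Lemma comps_unique S z z' t : comps S z -> comps S z' -> z t -> z' t -> z = z'.
Proof.
move=> [s _ <-] [s' _ <-] st s't.
by rewrite (same_connected_component st) (same_connected_component s't).
Qed.

Lemma comps_inhabited S z : comps S z -> exists t, z t.
Proof. by move=> [t Ht <-]; exists t; apply: connected_component_refl. Qed.

Lemma compsE S z t : comps S z -> z t -> z = connected_component (HA S) t.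
Proof. by move=> [s _ <-]; exact: same_connected_component. Qed.

Lemma comps_connected S z : comps S z -> connected z.
Proof. by move=> [t _ <-]; exact: component_connected. Qed.

Lemma comps_maximal S S' z z' t : comps S z -> comps S' z' -> z' `<=` HA S ->
  z t -> z' t -> z' `<=` z.
Proof.
move=> Sz Sz' z'S zt z't; rewrite (compsE Sz zt).
by apply: connected_component_max => //; exact: comps_connected Sz'.
Qed.

Lemma comps_sub_torus S z : comps S z -> z `<=` HA (finset.set0 : {set 'I_(size X)}).
Proof. by move=> [t _ <-] s /connected_component_sub [ts _]; rewrite HA_set0. Qed.

Lemma layer_sub_comps S S' C : comps S' C -> C `<=` HA S ->
  exists2 z, comps S z & C `<=` z.
Proof.
move=> [t Ht CE] CS; have Ct : C t by rewrite -CE; apply: connected_component_refl.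
exists (connected_component (HA S) t); first by exists t => //; exact: CS.
by apply: connected_component_max => //; rewrite -CE; exact: component_connected.
Qed.

Lemma comps_sub_HA S z : comps S z -> z `<=` HA S.
Proof. by move=> [t _ <-]; exact: connected_component_sub. Qed.

(** The closed form of [mu (TC C) C], as [mobius_layers] establishes. *)
Definition signed_count C : int :=
  \sum_(S : {set 'I_(size X)}) (if `[< comps S C >] then (-1) ^+ #|S| else 0).

Lemma exchange_layers (V : zmodType) (P : set (set (TT n Gt R)))
    (G : {set 'I_(size X)} -> set (TT n Gt R) -> V) : finite_set P ->
  \sum_(z \in P) \sum_S G S z = \sum_S \sum_(z \in P) G S z.
Proof.
move=> fP; rewrite fsbig_finite // exchange_big; apply: eq_bigr => S _.
by rewrite fsbig_finite.
Qed.

Hypothesis Xn0 : forall i : 'I_(size X), X`_i != 0.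

(** For each [S] the inner sum has one term if [C] lies in [HA S], and none otherwise. *)
Lemma sum_signed_count C : L C ->
  \sum_(z \in [set z | L z /\ C `<=` z]) signed_count z =
  (`[< comps (finset.set0 : {set 'I_(size X)}) C >])%:R.
Proof.
move=> [S0 CS0]; set P := [set z | _].
have fP : finite_set P by apply: sub_finite_set layers_finite => z [].
rewrite exchange_layers //.
pose A := [set i : 'I_(size X) | `[< forall t, C t -> t (X`_i, 0) = (1, 0) >]]%SET.
have [t Ct] := comps_inhabited CS0.
have AP S : (C `<=` HA S) <-> (S \subset A).
  split=> [CS|SA s Cs].
    apply/fintype.subsetP => i iS; rewrite inE; apply/asboolP => s /CS[_]; exact.
  split; first by have [] := comps_sub_HA CS0 Cs.
  by move=> i /(fintype.subsetP SA); rewrite inE => /asboolP; apply.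
transitivity (\sum_(S : {set 'I_(size X)} | S \subset A) (-1) ^+ #|S| : int).
  rewrite [RHS]big_mkcond; apply: eq_bigr => S _; case: ifPn => SA.
    have [z Sz Cz] := layer_sub_comps CS0 (iffRL (AP S) SA).
    have Pz : P z by split=> //; exists S.
    rewrite (fsbigD1 z) //=.
    have -> : `[< comps S z >] by apply/asboolP.
    rewrite fsbig1 ?addr0 // => y [[Ly Cy] yz]; case: asboolP => // Sy.
    by case: yz; apply: comps_unique Sy Sz (Cy _ Ct) (Cz _ Ct).
  apply: fsbig1 => z [_ Cz]; case: asboolP => // Sz.
  case/negP: SA; apply/AP => s /Cz; exact: comps_sub_HA.
rewrite sum_sign_subsets; congr (nat_of_bool _)%:R; apply/eqP/asboolP => [A0|C0].
  have -> // : finset.set0 = S0.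
  apply/esym/eqP; rewrite -finset.subset0 -A0; apply/AP; exact: comps_sub_HA.
apply/finset.setP => i; rewrite [RHS]inE; apply/negbTE; rewrite inE; apply/asboolP => iC.
have tt : torus t by have [] := comps_sub_HA C0 Ct.
have [|t' tt' []] := @torus_component_nontrivial n Gt R X t i _ tt; first exact: Xn0.
by apply: iC; rewrite (compsE C0 Ct) HA_set0.
Qed.

(** By [sum_signed_count], [signed_count] obeys the recursion defining [mu x0]; the induction is on
    the number of layers containing [y]. *)
Lemma mobius_layers (mu : set (TT n Gt R) -> set (TT n Gt R) -> int) x0 y :
  is_mobius L mu -> comps (finset.set0 : {set 'I_(size X)}) x0 -> L y -> y `<=` x0 ->
  mu x0 y = signed_count y.
Proof.
move=> muP x00; have Lx0 : L x0 by exists finset.set0.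
pose up y := [set z | L z /\ y `<=` z].
have fup y' : finite_set (up y') by apply: sub_finite_set layers_finite => z [].
have [k] := ubnP #|` fset_set (up y)|%fset; elim: k y => // k IH y.
rewrite ltnS => yk Ly yx0.
have [S0 yS0] := Ly; have [t yt] := comps_inhabited yS0.
have upx0 z : up y z -> z `<=` x0.
  move=> [[Sz zSz] yz]; apply: (comps_maximal x00 zSz _ (yx0 _ yt) (yz _ yt)).
  exact: comps_sub_torus zSz.
(* A layer containing [y] is connected and meets [x0], so it automatically lies in [x0]. *)
have upE : [set z | [/\ L z, z `<=` x0, y `<=` z & z <> y]] = up y `\` [set y].
  apply/seteqP; split=> [z [Lz _ yz zy]|z [[Lz yz] zy]]; first by split.
  by split=> //; apply: upx0.
have upy : up y y by split.
have := sum_signed_count Ly; rewrite -/(up y) (fsbigD1 y) //= => key.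
rewrite muP //; case: asboolP => [xy|xy].
  move: key; rewrite -[in `[< comps _ y >]]xy (asboolT x00) fsbig1 ?addr0 // => z [upz].
  by case; apply/seteqP; split; [rewrite -xy; exact: upx0|case: upz].
rewrite (asboolT yx0) upE; move: key; rewrite asboolF; last first.
  by move=> y0; apply: xy; apply: comps_unique x00 y0 (yx0 _ yt) yt.
move/eqP; rewrite addr_eq0 => /eqP ->; congr (- _).
apply: eq_fsbigr => z /set_mem [upz zy].
apply: IH; [|by case: upz|exact: upx0].
(* The count drops strictly: layers above [z] are above [y], but [y] itself is not above [z]. *)
apply: leq_trans yk; rewrite -add1n.
have <- : #|` y |` fset_set (up z)|%fset = (1 + #|` fset_set (up z)|%fset)%N.
  rewrite cardfsU1 in_fset_set // (_ : (y \notin up z) = true) //.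
  apply/negP => /set_mem [_ zy']; apply: zy; apply/seteqP; split=> //.
  by case: upz.
apply: fsubset_leq_card; apply/fsubsetP => w; rewrite !inE => /orP[/eqP ->|].
  by rewrite in_fset_set // mem_set.
rewrite !in_fset_set // => /set_mem [Lw zw]; apply: mem_set; split=> //.
by case: upz => _ yz; apply: subset_trans zw.
Qed.

(** [C] is connected, so all its points have the same component in the torus. *)
Lemma TC_component C : L C -> exists2 x0, comps (finset.set0 : {set 'I_(size X)}) x0 &
  TC C = x0 /\ C `<=` x0.
Proof.
move=> [S CS]; have [t Ct] := comps_inhabited CS.
have CT := comps_sub_torus CS; rewrite HA_set0 in CT.
have C0 : C `<=` connected_component (@torus n Gt R) t.
  by apply: connected_component_max => //; exact: comps_connected CS.
exists (connected_component (@torus n Gt R) t).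
  by exists t; rewrite HA_set0 //; exact: CT.
split=> //; apply/seteqP; split=> [s [c Cc cs]|s ts]; last by exists t.
by rewrite (same_connected_component (C0 _ Cc)).
Qed.

End Layers.

(** * Comparison of the two polynomials *)

Theorem theorem5p6 (n : nat) (Gt : finZmodType) (R : realType) (X : seq (Lam n)) :
  (forall x, x \in X -> x != 0) ->
  (exists s : seq (Lam n), forall l : Lam n,
      exists2 w, w \in s & exists c : 'I_(size X) -> int,
        l - w = \sum_(i < size X) X`_i *~ c i) ->
  forall mu : set (TT n Gt R) -> set (TT n Gt R) -> int,
    is_mobius (@layers n Gt R X) mu ->
    (-1) ^+ n * @tutteM n Gt R X _ (1 - 'X : {poly int}) 0
    = \sum_(C \in @layers n Gt R X) (mu (TC C) C)%:P * 'X^(cdim C).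
Proof.
move=> X0 Xfin mu muP.
have Xn0 (i : 'I_(size X)) : X`_i != 0 by apply: X0; exact: mem_nth.
(* A sum over pairs of a layer and a sublist. Summing over layers first counts components and gives
   [tutteM]; summing over sublists first gives the Moebius values. *)
transitivity (\sum_(C \in @layers n Gt R X)
    \sum_S (if `[< @comps n Gt R X S C >] then (-1) ^+ #|S| * 'X^(n - rk R S) else 0 : {poly int})).
  rewrite exchange_layers; last exact: layers_finite.
  rewrite /tutteM mulr_sumr; apply: eq_bigr => S _.
  rewrite comps_fsbig rk_full // sub0r.
  have rS := rk_le_card R S; have rn : (rk R S <= n)%N by apply: rank_leq_col.
  rewrite [1 - 'X - 1]addrAC subrr sub0r [(- 'X) ^+ _]exprNn.
  rewrite -[RHS]mulr_natl.
  (* $n+(n-r)+(|S|-r)$ has the parity of $|S|$; the bounds [rn] and [rS] make the truncated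
     subtractions exact. *)
  have -> : (-1) ^+ #|S| = (-1) ^+ n * (-1) ^+ (n - rk R S) * (-1) ^+ (#|S| - rk R S) :> {poly int}.
    rewrite -!exprD -signr_odd -[RHS]signr_odd; congr (_ ^+ nat_of_bool _).
    rewrite !oddD !oddB //; by case: odd; case: odd; case: odd.
  ring.
apply: eq_fsbigr => C /set_mem LC; have [S CS] := LC.
have [x0 x00 [-> Cx0]] := TC_component LC.
rewrite (mobius_layers Xn0 muP x00 LC Cx0) /signed_count rmorph_sum mulr_suml.
apply: eq_bigr => S' _; case: asboolP => [CS'|_]; last by rewrite rmorph0 mul0r.
(* Every [S'] having [C] as a component gives the same exponent [cdim C]. *)
by rewrite (cdim_comps CS') rmorphXn rmorphN1.
Qed.
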